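(* In base $3$, there is a unique infinite path in the child graph $G_c$ that starts at $1$; that is, there is exactly one infinite sequence of positive integers $a(1), a(2), a(3), \ldots$ with $a(1) = 1$ such that $a(n+1)$ is a comma-child of $a(n)$ in base $3$ for every $n \ge 1$. Moreover, this path is constructed by the following rule: starting from $1$, at a node with exactly one comma-child the path moves to that child, and at the successive branch-points reached along the path (the first of which is the node $1$ itself) the path alternately chooses the lower and the higher of the two comma-children (lower at the first branch-point, higher at the second, lower at the third, and so on).
   Context: Work in base $b = 3$. For a positive integer $n$, let $\delta(n)$ denote its leading (most significant, nonzero) base-$b$ digit. For positive integers $k, k'$, we say that $k'$ is a comma-child of $k$ (in base $b$) if $k' - k = d\cdot b + \delta(k')$, where $d = k \bmod b$ is the last base-$b$ digit of $k$. (A positive integer has at most two comma-children.) The child graph $G_c$ (in base $b$) is the directed graph whose nodes are the positive integers, with an edge from $i$ to $j$ exactly when $j$ is a comma-child of $i$. Paths are directed paths. A branch-point is a node with exactly two comma-children. *)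

(* Defs.v *)
From mathcomp Require Import all_boot.
From mathcomp Require Import boolp.

Set Implicit Arguments.
Unset Strict Implicit.
Unset Printing Implicit Defensive.

Definition leading_digit (b n : nat) : nat := n %/ b ^ trunc_log b n.

(* [k' - k = d * b + leading_digit b k'] with [d = k %% b], written additively
   because subtraction on [nat] is truncated. *)
Definition comma_child (b k k' : nat) : Prop :=
  [/\ 0 < k, 0 < k' & k' = k + ((k %% b) * b + leading_digit b k')].

Definition only_child (b k j : nat) : Prop :=
  forall j', comma_child b k j' <-> j' = j.

Definition two_children (b k lo hi : nat) : Prop :=
  lo < hi /\ forall j, comma_child b k j <-> j = lo \/ j = hi.

Definition branch_point (b k : nat) : Prop :=
  exists lo hi, two_children b k lo hi.

(* Paths are indexed from 0. *)
Definition infinite_path_from (b k : nat) (a : nat -> nat) : Prop :=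
  a 0 = k /\ forall n, comma_child b (a n) (a n.+1).

Definition branch_points_before (b : nat) (a : nat -> nat) (n : nat) : nat :=
  count (fun i => `[< branch_point b (a i) >]) (iota 0 n).

(* At the branch-point [a n], an even number of earlier branch-points means that
   it is the first, third, ... one along the path. *)
Definition alternating_rule (b : nat) (a : nat -> nat) : Prop :=
  forall n,
    (forall j, only_child b (a n) j -> a n.+1 = j) /\
    (forall lo hi, two_children b (a n) lo hi ->
       a n.+1 = if odd (branch_points_before b a n) then hi else lo).

(* Main.v *)
(** The leading digit is constant on a stretch [3^m, 2*3^m) or
    [2*3^m, 3^(m+1)), so the walk there is forced and every three steps advance
    it by 12, resp. 15.  A node can have two children only at [2*3^m - 5] and
    none only at [3^m - 5], so which of these a walk meets depends only on
    [3^m] modulo 60, that is on [m] modulo 4 for [m > 0].  Following the two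
    children of the fork [2*3^m - 5] until the next fork or dead end gives
      - [m = 1 mod 4]: lower -> fork [m + 1], higher -> fork [m + 3];
      - [m = 2 mod 4]: lower -> fork [m + 1], higher -> fork [m + 3];
      - [m = 3] or [0 mod 4]: both children run into a dead end.
    Hence from [1], the fork [m = 1], the only way to survive is lower to a fork
    with [m = 2 mod 4], then higher to a fork with [m = 1 mod 4], and so on. *)

Require Import Defs.
From mathcomp Require Import all_boot.
From mathcomp Require Import boolp.
From mathcomp Require Import zify.

Set Implicit Arguments.
Unset Strict Implicit.
Unset Printing Implicit Defensive.

(** * Leading digits and comma-children in base 3 *)

Lemma leading_digit3P m c n :
  c * 3 ^ m <= n < c.+1 * 3 ^ m -> 0 < c < 3 -> leading_digit 3 n = c.
Proof.
move=> /andP[cn nc] /andP[c0 c3].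
have m0 : 0 < 3 ^ m by rewrite expn_gt0.
have -> : leading_digit 3 n = n %/ 3 ^ m.
  rewrite /leading_digit (@trunc_log_eq 3 m n) //.
  by rewrite expnS; apply/andP; split; nia.
by apply/eqP; rewrite eqn_leq -ltnS ltn_divLR// nc leq_divRL.
Qed.

Lemma leading_digit3_bounds n : 0 < n -> 0 < leading_digit 3 n < 3.
Proof.
move=> n0; rewrite /leading_digit.
have /andP[lo hi] := trunc_log_bounds (isT : 1 < 3) n0.
by rewrite divn_gt0 ?expn_gt0// lo ltn_divLR ?expn_gt0// -expnS.
Qed.

(** The defining equation has the child on both sides. Guessing its leading digit [c] leaves two
    candidates, each to be tested for consistency. *)
Lemma comma_child3E k j : comma_child 3 k j <->
  [/\ 0 < k & exists2 c, (c = 1 \/ c = 2) &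
     j = k + 3 * (k %% 3) + c /\ leading_digit 3 j = c].
Proof.
split=> [[k0 j0 e]|[k0 [c cE [e l]]]].
  split=> //; exists (leading_digit 3 j); last by split=> //; lia.
  by have := leading_digit3_bounds j0; lia.
by split=> //; lia.
Qed.

(** Both candidates lie on one stretch of leading digit [c], so only the guess [c] is consistent. *)
Lemma only_child_lead m c k :
  0 < k -> c = 1 \/ c = 2 -> c * 3 ^ m <= k + 3 * (k %% 3) + 1 ->
  k + 3 * (k %% 3) + 2 < c.+1 * 3 ^ m ->
  only_child 3 k (k + 3 * (k %% 3) + c).
Proof.
move=> k0 c12 lo hi j; rewrite comma_child3E.
have lead d : d = 1 \/ d = 2 -> leading_digit 3 (k + 3 * (k %% 3) + d) = c.
  by move=> d12; apply: (@leading_digit3P m); lia.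
split=> [[_ [d d12 [-> l]]]|->]; first by rewrite lead in l; rewrite ?l.
by split=> //; exists c => //; split=> //; exact: lead.
Qed.

(** * Nodes with two children or none *)

Definition fork (m : nat) : nat := 2 * 3 ^ m - 5.

(** The last digit is 1, so the candidates fall on either side of the boundary [2 * 3 ^ m], and both
    guesses are consistent. *)
Lemma fork_children m : 0 < m ->
  two_children 3 (fork m) (2 * 3 ^ m - 1) (2 * 3 ^ m).
Proof.
case: m => // m _; have m0 : 0 < 3 ^ m by rewrite expn_gt0.
have s := expnS 3 m; rewrite /fork; split=> [|j]; first lia.
have l1 : leading_digit 3 (2 * 3 ^ m.+1 - 1) = 1.
  by apply: (@leading_digit3P m.+1); lia.
have l2 : leading_digit 3 (2 * 3 ^ m.+1) = 2.
  by apply: (@leading_digit3P m.+1); lia.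
rewrite comma_child3E; split=> [[_ [c c12 [-> _]]]|]; first lia.
by case=> ->; split; [lia|exists 1; lia|lia|exists 2; lia].
Qed.

(** The candidates are [3 ^ m - 1], which needs leading digit 1 but has 2, and [3 ^ m], which needs
    2 but has 1. *)
Lemma childless m j : 1 < m -> ~ comma_child 3 (3 ^ m - 5) j.
Proof.
case: m => [|[|m]]// _; have m0 : 0 < 3 ^ m by rewrite expn_gt0.
have s1 := expnS 3 m; have s2 := expnS 3 m.+1.
rewrite comma_child3E => -[_ [c c12 [-> l]]].
have jE : 3 ^ m.+2 - 5 + 3 * ((3 ^ m.+2 - 5) %% 3) + c = 3 ^ m.+2 - 2 + c by lia.
rewrite {}jE in l; case: c12 l => ->.
  by rewrite (@leading_digit3P m.+1 2); lia.
by rewrite (@leading_digit3P m.+2 1); lia.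
Qed.

(** * Forced walks along and across stretches *)

Inductive forced (k : nat) : nat -> Prop :=
| forced_refl : forced k k
| forced_step j l : only_child 3 k j -> forced j l -> forced k l.

Lemma forced_trans j k l : forced k j -> forced j l -> forced k l.
Proof. by elim=> // {}k i {}j kij _ IH /IH; exact: forced_step kij. Qed.

Lemma forced_to m c k j l : 0 < k -> c = 1 \/ c = 2 ->
  j = k + 3 * (k %% 3) + c -> c * 3 ^ m <= k + 3 * (k %% 3) + 1 ->
  k + 3 * (k %% 3) + 2 < c.+1 * 3 ^ m -> forced j l -> forced k l.
Proof.
by move=> k0 c12 -> lo hi; apply: forced_step; apply: (@only_child_lead m).
Qed.

(** Each step adds 1 to the last digit modulo 3, so three steps add [3 * (0 + 1 + 2) + 3 = 12]. The
    [+ 1] in the bound keeps the rejected last candidate on the stretch. *)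
Lemma forced_run1 m q k : 3 ^ m <= k -> k + 12 * q + 1 < 2 * 3 ^ m ->
  forced k (k + 12 * q).
Proof.
have m0 : 0 < 3 ^ m by rewrite expn_gt0.
elim: q k => [|q IH] k lo hi; first by rewrite muln0 addn0; exact: forced_refl.
have -> : k + 12 * q.+1 = (k + 12) + 12 * q by lia.
apply: (@forced_trans (k + 12)); last by apply: IH; lia.
do 3 (apply: (@forced_to m 1); [lia|lia|reflexivity|lia|lia|]).
match goal with |- forced ?a _ => have -> : a = k + 12 by lia end.
exact: forced_refl.
Qed.

(** Three steps add [3 * (0 + 1 + 2) + 6 = 15]. Here the rejected candidate is the smaller one. *)
Lemma forced_run2 m q k : 2 * 3 ^ m <= k -> k + 15 * q < 3 * 3 ^ m ->
  forced k (k + 15 * q).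
Proof.
have m0 : 0 < 3 ^ m by rewrite expn_gt0.
elim: q k => [|q IH] k lo hi; first by rewrite muln0 addn0; exact: forced_refl.
have -> : k + 15 * q.+1 = (k + 15) + 15 * q by lia.
apply: (@forced_trans (k + 15)); last by apply: IH; lia.
do 3 (apply: (@forced_to m 2); [lia|lia|reflexivity|lia|lia|]).
match goal with |- forced ?a _ => have -> : a = k + 15 by lia end.
exact: forced_refl.
Qed.

Lemma forced_to_end1 m f u : 1 < u -> f + u <= 3 ^ m ->
  3 ^ m = f + u %[mod 12] -> forced (3 ^ m + f) (2 * 3 ^ m - u).
Proof.
move=> u1 le e.
have -> : 2 * 3 ^ m - u = 3 ^ m + f + 12 * ((3 ^ m - f - u) %/ 12) by lia.
by apply: (@forced_run1 m); lia.
Qed.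

Lemma forced_to_end2 m f u : 0 < u -> f + u <= 3 ^ m ->
  3 ^ m = f + u %[mod 15] -> forced (2 * 3 ^ m + f) (3 ^ m.+1 - u).
Proof.
move=> u0 le e; rewrite expnS.
have -> : 3 * 3 ^ m - u = 2 * 3 ^ m + f + 15 * ((3 ^ m - f - u) %/ 15) by lia.
by apply: (@forced_run2 m); lia.
Qed.

Lemma modn3_exp m : 1 < 3 ^ m -> 3 ^ m %% 3 = 0.
Proof. by case: m => // m _; rewrite expnS; lia. Qed.

(** This is distance 6 from [2 * 3 ^ m], the one absent from the list in [forced_rise]: the next
    step lands on the fork. *)
Lemma forced_fork m f : f + 6 <= 3 ^ m -> 3 ^ m = f + 6 %[mod 12] ->
  forced (3 ^ m + f) (fork m).
Proof.
move=> le e; apply: (@forced_trans (2 * 3 ^ m - 6)).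
  exact: forced_to_end1.
have := @modn3_exp m ltac:(lia) => d.
apply: (@forced_to m 1 _ (fork m)); rewrite /fork; try lia.
exact: forced_refl.
Qed.

(* [u] is the distance of the last multiple of 3 of the form [3^m + f + 12 q] to
   the boundary [2 * 3^m]; the pairs [(u, g)] list how each distance is carried
   across it, up to the next multiple of 3. *)
Lemma forced_rise m f u g : (u, g) \in [:: (3, 3); (9, 9); (12, 6)] ->
  g < 3 ^ m -> f + u <= 3 ^ m -> 3 ^ m = f + u %[mod 12] ->
  forced (3 ^ m + f) (2 * 3 ^ m + g).
Proof.
move=> ug gx le e; apply: (@forced_trans (2 * 3 ^ m - u)).
  by apply: forced_to_end1 => //; move: ug; rewrite !inE => /or3P[] /eqP[-> _].
move: ug gx le {e}; rewrite !inE => /or3P[] /eqP[-> ->] gx le;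
  have := @modn3_exp m ltac:(lia) => d.
- apply: (@forced_to m 1 _ (2 * 3 ^ m - 2)); try lia.
  apply: (@forced_to m 2 _ (2 * 3 ^ m + 3)); try lia.
  exact: forced_refl.
- apply: (@forced_to m 1 _ (2 * 3 ^ m - 8)); try lia.
  apply: (@forced_to m 1 _ (2 * 3 ^ m - 4)); try lia.
  apply: (@forced_to m 2 _ (2 * 3 ^ m + 4)); try lia.
  apply: (@forced_to m 2 _ (2 * 3 ^ m + 9)); try lia.
  exact: forced_refl.
- apply: (@forced_to m 1 _ (2 * 3 ^ m - 11)); try lia.
  apply: (@forced_to m 1 _ (2 * 3 ^ m - 7)); try lia.
  apply: (@forced_to m 2 _ (2 * 3 ^ m + 1)); try lia.
  apply: (@forced_to m 2 _ (2 * 3 ^ m + 6)); try lia.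
  exact: forced_refl.
Qed.

(** Counterpart of [forced_rise] at the boundary [3 ^ m.+1]. Distance 15 is absent because it leads
    to a dead end, as [doomed_end] shows. *)
Lemma forced_climb m f u g :
  (u, g) \in [:: (3, 6); (6, 3); (9, 0); (12, 9)] ->
  f + u <= 3 ^ m -> 3 ^ m = f + u %[mod 15] ->
  forced (2 * 3 ^ m + f) (3 ^ m.+1 + g).
Proof.
move=> ug le e; apply: (@forced_trans (3 ^ m.+1 - u)).
  by apply: forced_to_end2 => //; move: ug; rewrite !inE => /or4P[] /eqP[-> _].
have := expnS 3 m => s.
move: ug le {e}; rewrite !inE => /or4P[] /eqP[-> ->] le;
  have := @modn3_exp m ltac:(lia) => d.
- apply: (@forced_to m 2 _ (3 ^ m.+1 - 1)); try lia.
  apply: (@forced_to m.+1 1 _ (3 ^ m.+1 + 6)); try lia.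
  exact: forced_refl.
- apply: (@forced_to m 2 _ (3 ^ m.+1 - 4)); try lia.
  apply: (@forced_to m.+1 1 _ (3 ^ m.+1 + 3)); try lia.
  exact: forced_refl.
- apply: (@forced_to m 2 _ (3 ^ m.+1 - 7)); try lia.
  apply: (@forced_to m.+1 1 _ (3 ^ m.+1 + 0)); try lia.
  exact: forced_refl.
- apply: (@forced_to m 2 _ (3 ^ m.+1 - 10)); try lia.
  apply: (@forced_to m 2 _ (3 ^ m.+1 - 2)); try lia.
  apply: (@forced_to m.+1 1 _ (3 ^ m.+1 + 2)); try lia.
  apply: (@forced_to m.+1 1 _ (3 ^ m.+1 + 9)); try lia.
  exact: forced_refl.
Qed.

(** * Nodes from which no infinite path starts *)

Definition doomed (k : nat) : Prop := forall a, ~ infinite_path_from 3 k a.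

Lemma path_shift b k a n : infinite_path_from b k a ->
  infinite_path_from b (a n) (fun i => a (n + i)).
Proof. by move=> [_ ch]; split=> [|i]; rewrite ?addn0 ?addnS. Qed.

Lemma doomed_children k : (forall j, comma_child 3 k j -> doomed j) -> doomed k.
Proof.
move=> d a pa; apply: (d (a 1)); last exact: (path_shift 1 pa).
by case: pa => <-.
Qed.

Lemma forced_doomed k l : forced k l -> doomed l -> doomed k.
Proof.
elim=> // {}k j {}l kj _ IH dl; apply: doomed_children => i /kj ->; exact: IH.
Qed.

Lemma doomed_fork m : 0 < m -> doomed (2 * 3 ^ m - 1) -> doomed (2 * 3 ^ m) ->
  doomed (fork m).
Proof.
move=> m0 dl dh; apply: doomed_children => j.
by have [_ E] := fork_children m0; move=> /E[] ->.
Qed.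

(** At distance 15 from [3 ^ m.+1], two more forced steps reach the childless node
    [3 ^ m.+1 - 5]. *)
Lemma doomed_end m f : f + 15 <= 3 ^ m -> 3 ^ m = f %[mod 15] ->
  doomed (2 * 3 ^ m + f).
Proof.
move=> le e; apply: (@forced_doomed _ (3 ^ m.+1 - 15)).
  by apply: forced_to_end2 => //; lia.
have := expnS 3 m => s; have := @modn3_exp m ltac:(lia) => d.
have m0 : 0 < m by case: m le {e s d} => [|//]; rewrite expn0; lia.
apply: (@forced_doomed _ (3 ^ m.+1 - 5)).
  apply: (@forced_to m 2 _ (3 ^ m.+1 - 13)); try lia.
  apply: (@forced_to m 2 _ (3 ^ m.+1 - 5)); try lia.
  exact: forced_refl.
by apply: doomed_children => j /childless; case.
Qed.

(** * The fate of the two children of a fork *)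

Lemma forced_low m : 12 < 3 ^ m -> forced (2 * 3 ^ m - 1) (2 * 3 ^ m + 12).
Proof.
move=> le; have := @modn3_exp m ltac:(lia) => d.
apply: (@forced_to m 2 _ (2 * 3 ^ m + 7)); try lia.
apply: (@forced_to m 2 _ (2 * 3 ^ m + 12)); try lia.
exact: forced_refl.
Qed.

(* Here and below the numeric suffix is the residue of [3 ^ m] modulo 60. *)
Lemma doomed_fork27 m : 3 ^ m = 27 %[mod 60] -> doomed (fork m).
Proof.
move=> r; have m0 : 0 < m by case: m r.
have e := expnS 3 m.
apply: doomed_fork => //.
  apply: (forced_doomed (@forced_low m _)); first lia.
  by apply: (@doomed_end m 12); lia.
rewrite -[2 * _]addn0.
apply: (forced_doomed (@forced_climb m 0 12 9 isT _ _)); [lia|lia|].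
apply: (forced_doomed (@forced_rise m.+1 9 12 6 isT _ _ _)); [lia|lia|lia|].
by apply: (@doomed_end m.+1 6); lia.
Qed.

Lemma doomed_fork21 m : 3 ^ m = 21 %[mod 60] -> doomed (fork m).
Proof.
move=> r; have m0 : 0 < m by case: m r.
(* These equations carry the residue modulo 60, the least common multiple of the periods 12 and 15,
   to the higher powers. *)
have e1 := expnS 3 m.
have e2 := expnS 3 m.+1.
have e3 := expnS 3 m.+2.
have e4 := expnS 3 m.+3.
have e5 := expnS 3 m.+4.
have e6 := expnS 3 m.+4.+1.
apply: doomed_fork => //.
  apply: (forced_doomed (@forced_low m _)); first lia.
  apply: (forced_doomed (@forced_climb m 12 9 0 isT _ _)); [lia|lia|].
  apply: (forced_doomed (@forced_rise m.+1 0 3 3 isT _ _ _)); [lia|lia|lia|].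
  by apply: (@doomed_end m.+1 3); lia.
(* The higher child is offset 0 on its stretch; its walk ends only at [3 ^ (m + 7) - 5]. *)
rewrite -[2 * _]addn0.
apply: (forced_doomed (@forced_climb m 0 6 3 isT _ _)); [lia|lia|].
apply: (forced_doomed (@forced_rise m.+1 3 12 6 isT _ _ _)); [lia|lia|lia|].
apply: (forced_doomed (@forced_climb m.+1 6 12 9 isT _ _)); [lia|lia|].
apply: (forced_doomed (@forced_rise m.+2 9 12 6 isT _ _ _)); [lia|lia|lia|].
apply: (forced_doomed (@forced_climb m.+2 6 3 6 isT _ _)); [lia|lia|].
apply: (forced_doomed (@forced_rise m.+3 6 9 9 isT _ _ _)); [lia|lia|lia|].
apply: (forced_doomed (@forced_climb m.+3 9 3 6 isT _ _)); [lia|lia|].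
apply: (forced_doomed (@forced_rise m.+4 6 3 3 isT _ _ _)); [lia|lia|lia|].
apply: (forced_doomed (@forced_climb m.+4 3 3 6 isT _ _)); [lia|lia|].
apply: (forced_doomed (@forced_rise m.+4.+1 6 9 9 isT _ _ _)); [lia|lia|lia|].
apply: (forced_doomed (@forced_climb m.+4.+1 9 9 0 isT _ _)); [lia|lia|].
apply: (forced_doomed (@forced_rise m.+4.+2 0 9 9 isT _ _ _)); [lia|lia|lia|].
by apply: (@doomed_end m.+4.+2 9); lia.
Qed.

Lemma doomed_high3 m : 3 ^ m = 3 %[mod 60] -> doomed (2 * 3 ^ m).
Proof.
move=> r.
have e1 := expnS 3 m.
have e2 := expnS 3 m.+1.
have e3 := expnS 3 m.+2.
rewrite -[2 * _]addn0.
apply: (forced_doomed (@forced_climb m 0 3 6 isT _ _)); [lia|lia|].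
apply: (forced_doomed (@forced_rise m.+1 6 3 3 isT _ _ _)); [lia|lia|lia|].
apply: (forced_doomed (@forced_climb m.+1 3 6 3 isT _ _)); [lia|lia|].
apply: (forced_doomed (@forced_rise m.+2 3 12 6 isT _ _ _)); [lia|lia|lia|].
apply: (forced_doomed (@forced_climb m.+2 6 6 3 isT _ _)); [lia|lia|].
(* The fork reached has residue [3 * 27 = 81], that is 21, modulo 60. *)
apply: (forced_doomed (@forced_fork m.+3 3 _ _)); [lia|lia|].
by apply: doomed_fork21; lia.
Qed.

Lemma forced_low3 m : 3 ^ m = 3 %[mod 60] ->
  forced (2 * 3 ^ m - 1) (fork m.+1).
Proof.
move=> r.
have e1 := expnS 3 m.
(* For [3 ^ m = 3] the stretch is too short for [forced_low]; the walk goes from 5 straight to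
   12. *)
have [x3|le] : 3 ^ m = 3 \/ 12 < 3 ^ m by lia.
  apply: (@forced_to m.+1 1 _ (3 ^ m.+1 + 3)); try lia.
  by apply: (@forced_fork m.+1 3); lia.
apply: (forced_trans (forced_low le)).
apply: (forced_trans (@forced_climb m 12 6 3 isT _ _)); [lia|lia|].
by apply: (@forced_fork m.+1 3); lia.
Qed.

Lemma doomed_low9 m : 3 ^ m = 9 %[mod 60] -> doomed (2 * 3 ^ m - 1).
Proof.
move=> r.
have e1 := expnS 3 m.
have [x9|le] : 3 ^ m = 9 \/ 12 < 3 ^ m by lia.
  (* For [3 ^ m = 9] this is the walk 17, 25, 29, 36. *)
  have up : forced (2 * 3 ^ m - 1) (3 ^ m.+1 + 9).
    apply: (@forced_to m 2 _ (2 * 3 ^ m + 7)); try lia.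
    apply: (@forced_to m.+1 1 _ (3 ^ m.+1 + 2)); try lia.
    apply: (@forced_to m.+1 1 _ (3 ^ m.+1 + 9)); try lia.
    exact: forced_refl.
  apply: (forced_doomed up).
  apply: (forced_doomed (@forced_fork m.+1 9 _ _)); [lia|lia|].
  by apply: doomed_fork27; lia.
apply: (forced_doomed (forced_low le)).
apply: (forced_doomed (@forced_climb m 12 12 9 isT _ _)); [lia|lia|].
apply: (forced_doomed (@forced_fork m.+1 9 _ _)); [lia|lia|].
by apply: doomed_fork27; lia.
Qed.

Lemma forced_high9 m : 3 ^ m = 9 %[mod 60] ->
  forced (2 * 3 ^ m) (fork m.+3).
Proof.
move=> r.
have e1 := expnS 3 m.
have e2 := expnS 3 m.+1.
have e3 := expnS 3 m.+2.
rewrite -[2 * _]addn0.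
apply: (forced_trans (@forced_climb m 0 9 0 isT _ _)); [lia|lia|].
apply: (forced_trans (@forced_rise m.+1 0 3 3 isT _ _ _)); [lia|lia|lia|].
apply: (forced_trans (@forced_climb m.+1 3 9 0 isT _ _)); [lia|lia|].
apply: (forced_trans (@forced_rise m.+2 0 9 9 isT _ _ _)); [lia|lia|lia|].
apply: (forced_trans (@forced_climb m.+2 9 12 9 isT _ _)); [lia|lia|].
by apply: (@forced_fork m.+3 9); lia.
Qed.

(** * The invariant along the surviving path *)

Lemma two_children_inj b k lo hi lo' hi' :
  two_children b k lo hi -> two_children b k lo' hi' -> lo' = lo /\ hi' = hi.
Proof.
move=> [lt E] [lt' E'].
have := E' lo; rewrite E => -[/(_ (or_introl erefl)) H1 _].
have := E' hi; rewrite E => -[/(_ (or_intror erefl)) H2 _].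
by lia.
Qed.

Lemma only_child_not_branch b k j : only_child b k j -> ~ branch_point b k.
Proof.
move=> u [lo [hi [lt E]]].
have /u lj : comma_child b k lo by apply/E; left.
have /u hj : comma_child b k hi by apply/E; right.
by rewrite lj hj ltnn in lt.
Qed.

Definition chosen_child (p : bool) (k j : nat) : Prop :=
  (forall i, only_child 3 k i -> j = i) /\
  (forall lo hi, two_children 3 k lo hi -> j = if p then hi else lo).

(* [3 ^ m] is 3 resp. 9 modulo 60 iff [m] is 1 resp. 2 modulo 4; [p] is the
   parity of the number of branch-points passed so far. *)
Definition live (p : bool) (k : nat) : Prop :=
  exists2 m, 3 ^ m = (if p then 9 else 3) %[mod 60] & forced k (fork m).

(** Before the fork the child is forced and the parity is kept. At the fork the parity gives the
    residue of [3 ^ m], hence which child is doomed, and it flips. Existence, uniqueness and the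
    alternating rule all follow from this step. *)
Lemma live_step p k : live p k -> exists j,
  [/\ comma_child 3 k j,
      forall i, comma_child 3 k i -> i = j \/ doomed i,
      forall i, chosen_child p k i <-> i = j &
      live (p (+) `[<branch_point 3 k>]) j].
Proof.
move=> [m r]; move lE: (fork m) => l f.
case: f lE => [|j {}l kj f] lE; last first.
  exists j; split.
  - by apply/kj.
  - by move=> i /kj; left.
  - move=> i; split=> [[/(_ j kj)]//|->]; split=> [i' ki'|lo hi two].
      by apply/ki'/kj.
    by case: (only_child_not_branch kj); exists lo, hi.
  - rewrite asboolF ?addbF; last exact: only_child_not_branch kj.
    by exists m => //; rewrite lE.
have m0 : 0 < m by case: m r {lE} => //; case: p.
have two := fork_children m0.
rewrite -{}lE; exists (if p then 2 * 3 ^ m else 2 * 3 ^ m - 1).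
have [_ E] := two; split.
- by apply/E; case: p {r}; [right|left].
- move=> i /E; case: p r => r [->|->]; [right|left|left|right] => //.
    exact: doomed_low9.
  exact: doomed_high3.
- move=> i; split=> [[_ /(_ _ _ two)]//|->]; split=> [i' u|lo hi two'].
    by case: (only_child_not_branch u); do 2 eexists; exact: two.
  by have [-> ->] := two_children_inj two two'.
- rewrite asboolT ?addbT; last by do 2 eexists; exact: two.
  case: p r => r /=.
    exists m.+3; last exact: forced_high9.
    (* [9 * 27 = 243] is 3 modulo 60. *)
    by rewrite !expnS; lia.
  exists m.+1; last exact: forced_low3.
  by rewrite expnS; lia.
Qed.

(** The start is itself [fork 1]. *)
Lemma live1 : live false 1.
Proof. by exists 1 => //; exact: forced_refl. Qed.

Lemma branch_points_beforeS b a n : branch_points_before b a n.+1 =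
  branch_points_before b a n + `[<branch_point b (a n)>].
Proof. by rewrite /branch_points_before -addn1 iotaD count_cat /= addn0. Qed.

Lemma live_alternating a : a 0 = 1 -> alternating_rule 3 a ->
  forall n, live (odd (branch_points_before 3 a n)) (a n).
Proof.
move=> a0 ar; elim=> [|n IH]; first by rewrite a0; exact: live1.
have [j [_ _ cj lj]] := live_step IH.
have aj : a n.+1 = j by apply/cj; exact: ar.
by rewrite aj branch_points_beforeS oddD oddb.
Qed.

Lemma path_not_doomed k a n : infinite_path_from 3 k a -> ~ doomed (a n).
Proof. by move=> /(path_shift n) pa /(_ _ pa). Qed.

(** An infinite path meets no doomed node, so it must take the live child each time. *)
Lemma live_path a : infinite_path_from 3 1 a ->
  forall n, live (odd (branch_points_before 3 a n)) (a n).
Proof.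
move=> pa; elim=> [|n IH]; first by rewrite pa.1; exact: live1.
have [j [_ dj _ lj]] := live_step IH.
have [->|/(path_not_doomed pa)//] := dj _ (pa.2 n).
by rewrite branch_points_beforeS oddD oddb.
Qed.

Lemma path_alternating a :
  infinite_path_from 3 1 a <-> a 0 = 1 /\ alternating_rule 3 a.
Proof.
split=> [pa|[a0 ar]].
  split=> [|n]; first exact: pa.1.
  have [j [_ dj cj _]] := live_step (live_path pa n).
  have [aj|/(path_not_doomed pa)//] := dj _ (pa.2 n).
  exact/cj.
split=> // n; have [j [ch _ cj _]] := live_step (live_alternating a0 ar n).
by have -> : a n.+1 = j by apply/cj; exact: ar.
Qed.

Lemma path_unique a a' :
  infinite_path_from 3 1 a -> infinite_path_from 3 1 a' -> a = a'.
Proof.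
move=> pa pa'; apply/funext; elim=> [|n IH]; first by rewrite pa.1 pa'.1.
have [j [_ dj _ _]] := live_step (live_path pa n).
have [->|/(path_not_doomed pa)//] := dj _ (pa.2 n).
have ch : comma_child 3 (a n) (a' n.+1) by rewrite IH; exact: pa'.2.
by have [->|/(path_not_doomed pa')] := dj _ ch.
Qed.

Lemma path_exists : exists a, infinite_path_from 3 1 a.
Proof.
(* Choice needs a total successor function; the default value 0 is taken only at nodes that are not
   live. *)
have /choice[next nextP] : forall k, exists j, (exists p, live p k) ->
    comma_child 3 k j /\ exists p, live p j.
  move=> k; have [[p lk]|nl] := EM (exists p, live p k); last by exists 0.
  by have [j [ch _ _ lj]] := live_step lk; exists j => _; split=> //; eexists; exact: lj.
exists (fun n => iter n next 1); split=> // n.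
have lv : exists p, live p (iter n next 1).
  elim: n => [|n IH]; first by exists false; exact: live1.
  exact: (nextP _ IH).2.
exact: (nextP _ lv).1.
Qed.

Theorem theorem10p1 :
  (exists! a : nat -> nat, infinite_path_from 3 1 a) /\
  branch_point 3 1 /\
  (forall a : nat -> nat,
     infinite_path_from 3 1 a <-> a 0 = 1 /\ alternating_rule 3 a).
Proof.
split; last split.
- have [a pa] := path_exists; exists a; split=> // a'; exact: path_unique.
(* With [m = 1] the children of the fork are [2 * 3 - 1] and [2 * 3]. *)
- by exists 5, 6; exact: (@fork_children 1).
- exact: path_alternating.
Qed.
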